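(* For every graph $G$ of order $n$, we have $\textnormal{ftdim}(G)<n$ if and only if there exists $v\in V(G)$ such that for all $u\in V(G)$ with $u\ne v$ we have $N(u)-\{v\}\ne N(v)-\{u\}$.
   Context: Graphs are finite, simple, undirected, possibly disconnected; $\textnormal{dist}(u,v)=\infty$ between different components; $N(x)$ is the (open) neighborhood of $x$. A set $S=\{v_1,\dots,v_k\}$ of vertices is a resolving set of $G$ if the vectors $(\textnormal{dist}(u,v_1),\dots,\textnormal{dist}(u,v_k))$ are pairwise distinct over $u\in V(G)$. $\textnormal{ftdim}(G)$ is the minimum size of a nonempty $S\subseteq V(G)$ such that $S-\{s\}$ is a resolving set for every $s\in S$.
   Formalization: The formal theorem assumes n ≠ 1: for the one-vertex graph ftdim(G) = 1 = n, so ftdim(G) < n fails, while the condition on v holds vacuously, so the equivalence is false there. *)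

(* Defs.v *)
From mathcomp Require Import all_boot.

Set Implicit Arguments.
Unset Strict Implicit.
Unset Printing Implicit Defensive.

Record sgraph := SGraph {
  vertex :> finType;
  adj : rel vertex;
  adj_sym : symmetric adj;
  adj_irrefl : irreflexive adj
}.

Section Defs.
Variable G : sgraph.
Implicit Types (u v s : G) (S : {set G}) (k : nat).

Definition nbh v : {set G} := [set u | adj v u].

Definition walk k u v : bool :=
  [exists p : k.-tuple G, path (@adj G) u p && (last u p == v)].

Lemma walkP k u v :
  reflect (exists p : seq G, [/\ size p = k, path (@adj G) u p & last u p = v])
          (walk k u v).
Proof.
apply: (iffP existsP) => [[p /andP[pp /eqP lp]]|[p [sp pp lp]]].
  by exists p; rewrite size_tuple.
have sp' : size p == k by apply/eqP.
by exists (Tuple sp'); rewrite /= pp lp eqxx.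
Qed.

Lemma connect_walk u v : connect (@adj G) u v -> exists k, walk k u v.
Proof.
by case/connectP=> p pp lp; exists (size p); apply/walkP; exists p.
Qed.

(* [None] stands for the distance oo between distinct components. *)
Definition dist u v : option nat :=
  if decP (@idP (connect (@adj G) u v)) is left uv
  then Some (ex_minn (connect_walk uv)) else None.

Lemma dist_Some u v k :
  dist u v = Some k <-> walk k u v /\ forall j, walk j u v -> k <= j.
Proof.
rewrite /dist; case: decP => [uv|nuv].
  case: ex_minnP => m wm minm; split=> [[<-] //|[wk mink]].
  by congr Some; apply/eqP; rewrite eqn_leq minm // mink.
split=> // -[/walkP[p [_ pp lp]] _].
by case: nuv; apply/connectP; exists p.
Qed.

Lemma dist_None u v : dist u v = None <-> forall k, ~~ walk k u v.
Proof.
rewrite /dist; case: decP => [uv|nuv]; split=> //.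
  by have [k wk] := connect_walk uv => /(_ k); rewrite wk.
move=> _ k; apply/negP=> /walkP[p [_ pp lp]].
by case: nuv; apply/connectP; exists p.
Qed.

Definition resolving S : bool :=
  injectiveb (fun u => [seq dist u s | s in S]).

Definition ft_resolving S : bool :=
  (S != set0) && [forall s in S, resolving (S :\ s)].

(* The default [setT] of the minimum is itself an admissible set as soon as
   [G] has a vertex (see [ft_resolvingT]); the graph without vertices has no
   admissible set, and [ftdim] then takes the conventional value 0. *)
Definition ftdim : nat := #|[arg min_(S < [set: G] | ft_resolving S) #|S| ]|.

Lemma resolvingP S :
  reflect (forall u v, {in S, forall s, dist u s = dist v s} -> u = v)
          (resolving S).
Proof.
rewrite /resolving; apply: (iffP (injectiveP _)) => injS u v duv; apply: injS.
  by apply/eq_in_map => s; rewrite mem_enum; apply: duv.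
by move=> s Ss; move/eq_in_map: duv; apply; rewrite mem_enum.
Qed.

Lemma dist_eq0 u v : dist u v = Some 0 <-> u = v.
Proof.
split=> [/dist_Some[/walkP[p [/size0nil-> _ <-]]] //|<-].
by apply/dist_Some; split=> //; apply/walkP; exists [::].
Qed.

Lemma ft_resolvingT : 0 < #|G| -> ft_resolving [set: G].
Proof.
move=> G_gt0; rewrite /ft_resolving -card_gt0 cardsT G_gt0 /=.
apply/forall_inP=> s _; apply/resolvingP=> u v duv.
have [us|us] := eqVneq u s.
  have [vs|vs] := eqVneq v s; first by rewrite us vs.
  apply/dist_eq0; rewrite duv ?in_setD1 ?vs ?in_setT //.
  exact/dist_eq0.
apply/esym/dist_eq0; rewrite -duv ?in_setD1 ?us ?in_setT //.
exact/dist_eq0.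
Qed.

Lemma ftdim_spec : 0 < #|G| ->
  (exists2 S, ft_resolving S & #|S| = ftdim) /\
  (forall S, ft_resolving S -> ftdim <= #|S|).
Proof.
move=> G_gt0; rewrite /ftdim; case: arg_minnP; first exact: ft_resolvingT.
by move=> S ftS minS; split=> //; exists S.
Qed.

End Defs.

(* Main.v *)
Require Import Defs.
From mathcomp Require Import all_boot.

(** Call distinct [u] and [v] twins when [N(u) - v = N(v) - u].  Twins have the
    same distance to every third vertex, while a vertex at distance 1 from
    exactly one of [u], [v] tells them apart; so [V - {u, v}] resolves [G] iff
    [u], [v] are not twins.  Hence a vertex can be left out of a fault-tolerant
    resolving set iff it has no twin. *)

Lemma dist_eq1 (G : sgraph) (u w : G) : dist u w = Some 1 <-> adj u w.
Proof.
split=> [/dist_Some[/walkP[[|x [|? ?]] [//= _ /andP[ux _] <-]] //] _|uw].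
apply/dist_Some; split=> [|[|//]]; first by apply/walkP; exists [:: w]; rewrite /= uw.
by case/walkP=> p [/size0nil-> _ /= eq_uw]; rewrite eq_uw adj_irrefl in uw.
Qed.

(** Trading walks without lengthening them, in both directions, forces equal minima; it also covers
    infinite distance, as a walk on either side yields one on the other. *)
Lemma eq_dist_walks (G : sgraph) (u v w : G) :
    (forall k, walk k u w -> exists2 j, j <= k & walk j v w) ->
    (forall k, walk k v w -> exists2 j, j <= k & walk j u w) ->
  dist u w = dist v w.
Proof.
move=> uv vu; case du: (dist u w) => [k|]; apply/esym.
  have /dist_Some[wk mink] := du; apply/dist_Some.
  have min_vw i : walk i v w -> k <= i.
    by case/vu=> j ji /mink kj; apply: leq_trans ji.
  have [j jk wj] := uv k wk.
  have kj : k = j by apply/eqP; rewrite eqn_leq min_vw.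
  by split=> //; rewrite kj.
have /dist_None no_walk := du; apply/dist_None=> k; apply/negP=> /vu[j _ wj].
by move: (no_walk j); rewrite wj.
Qed.

(** The walk is nonempty as [u <> w]. If its first step leads to [v], drop that step; otherwise the
    step leads to a common neighbor of the twins, so it can start from [v] instead. *)
Lemma walk_twin (G : sgraph) (u v w : G) k :
    nbh u :\ v = nbh v :\ u -> u <> w -> walk k u w ->
  exists2 j, j <= k & walk j v w.
Proof.
move=> tw uw /walkP[[|x p] [<- //= pp lp]]; have /andP[ux xp] := pp.
have [xv|xv] := eqVneq x v.
  by exists (size p) => //; apply/walkP; exists p; rewrite -xv.
exists (size p).+1 => //; apply/walkP; exists (x :: p); split=> //=.
have : x \in nbh u :\ v by rewrite !inE xv ux.
by rewrite tw !inE xp => /andP[_ ->].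
Qed.

Lemma dist_twin (G : sgraph) (u v w : G) :
    nbh u :\ v = nbh v :\ u -> u <> w -> v <> w -> dist u w = dist v w.
Proof.
by move=> tw uw vw; apply: eq_dist_walks => k; apply: walk_twin.
Qed.

Lemma resolving_not_twin (G : sgraph) (S : {set G}) (u v : G) :
    resolving S -> u \notin S -> v \notin S -> u <> v ->
  nbh u :\ v <> nbh v :\ u.
Proof.
move=> /resolvingP resS uS vS uv tw; apply/uv/resS => s sS.
by apply: dist_twin => // eq_s; move: uS vS; rewrite eq_s sS.
Qed.

(** Any vertex of the set is singled out by its distance 0 to itself, so only the pair [u], [v]
    remains to be separated. *)
Lemma resolving_setC2 (G : sgraph) (u v : G) :
  nbh u :\ v <> nbh v :\ u -> resolving (~: [set u; v]).
Proof.
move=> ntw; apply/resolvingP=> x y dxy.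
have sep z t : {in ~: [set u; v], forall s, dist z s = dist t s} ->
    z \in ~: [set u; v] -> z = t.
  move=> dzt zS; apply/esym/dist_eq0.
  by rewrite -dzt //; apply/dist_eq0.
have [xS|xS] := boolP (x \in ~: [set u; v]); first exact: sep.
have [yS|yS] := boolP (y \in ~: [set u; v]).
  by apply/esym/sep => // s /dxy.
have dist_ne : ~ {in ~: [set u; v], forall s, dist u s = dist v s}.
  move=> duv; apply: ntw; apply/setP=> s; rewrite !inE.
  have [->|sv] := eqVneq s v; first by rewrite adj_irrefl andbF.
  have [->|su] := eqVneq s u; first by rewrite adj_irrefl.
  have duvs : dist u s = dist v s by apply: duv; rewrite !inE negb_or su.
  by apply/idP/idP => /dist_eq1 ds; apply/dist_eq1; rewrite -ds.
move: xS yS dxy; rewrite !inE !negbK.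
move=> /orP[]/eqP-> /orP[]/eqP-> // dxy; case: dist_ne => // s /dxy.
by move->.
Qed.

Theorem theorem4 (G : sgraph) (n : nat) (order_G : #|G| = n) (n_neq1 : n <> 1) :
  ftdim G < n <->
  exists v : G, forall u : G, u <> v -> nbh u :\ v <> nbh v :\ u.
Proof.
split=> [lt_n|[v ntw]].
  have G_gt0 : 0 < #|G| by rewrite order_G (leq_trans _ lt_n).
  have [[S /andP[S_n0 /forall_inP ftS] cardS] _] := ftdim_spec G_gt0.
  have [v _ vS] : exists2 v, v \in [set: G] & v \notin S.
    apply/subsetPn; apply: contraL lt_n => /subset_leq_card.
    by rewrite cardsT cardS order_G -leqNgt.
  exists v => u uv.
  (* Delete [u] itself if it lies in [S], and any element otherwise: the remaining resolving set
     misses both [u] and [v]. *)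
  have [s sS us] : exists2 s, s \in S & u \notin S :\ s.
    have [uS|uS] := boolP (u \in S); first by exists u; rewrite // !inE eqxx.
    by have [s sS] := set0Pn _ S_n0; exists s; rewrite // !inE (negPf uS) andbF.
  by apply: resolving_not_twin (ftS s sS) us _ uv; rewrite !inE (negPf vS) andbF.
have G_gt0 : 0 < #|G| by apply/card_gt0P; exists v.
have [_ /(_ [set~ v]) min_v] := ftdim_spec G_gt0.
have cardC := cardsC1 v.
have ltC : #|[set~ v]| < n by rewrite cardC -order_G prednK.
apply: leq_ltn_trans ltC; apply: min_v; apply/andP; split.
  (* Here [n <> 1] matters: the only vertex of a one-vertex graph has no twin, yet its complement is
     empty and [ftdim] is 1. *)
  rewrite -card_gt0 cardC order_G.
  by case: n order_G n_neq1 => [|[|]] // G0; rewrite G0 in G_gt0.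
apply/forall_inP=> s; rewrite !inE => /eqP sv.
suff -> : [set~ v] :\ s = ~: [set s; v] by apply/resolving_setC2/ntw.
by apply/setP=> x; rewrite !inE negb_or.
Qed.
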